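(* For any three graphs $G$, $H$ and $K$, the complex $\mathrm{Hom}(G,H\times K)$ is simple homotopy equivalent (in the sense of Whitehead) to $\mathrm{Hom}(G,H)\times\mathrm{Hom}(G,K)$.
   Context: Graphs are undirected, loops are allowed, multiple edges are not; $E(G)$ is regarded as a symmetric subset of $V(G)\times V(G)$. The direct product $H\times K$ of graphs has vertex set $V(H)\times V(K)$ and edge set $\{((x,y),(x',y')) : (x,x')\in E(H),\ (y,y')\in E(K)\}$. For graphs $T,G$, $\mathrm{Hom}(T,G)$ is the polyhedral complex whose cells are indexed by all functions $\eta:V(T)\to 2^{V(G)}\setminus\{\emptyset\}$ (with all $\eta(x)$ finite and $|\eta(x)|\ge 2$ for only finitely many $x$) such that $(x,y)\in E(T)$ implies $\eta(x)\times\eta(y)\subseteq E(G)$. The cell $\eta$ is the product of simplices $\prod_{x\in V(T)}\Delta^{\eta(x)}$ inside the weak direct product of copies of the simplex $\Delta^{V(G)}$ indexed by $V(T)$; its closure consists of all cells $\tilde\eta$ with $\tilde\eta(x)\subseteq\eta(x)$ for all $x\in V(T)$.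
   Formalization: The complex Hom(G,H×K) is assumed finite (G, H, K need not be), since simple homotopy equivalence in Whitehead's sense is defined for finite complexes; with finite formal deformations the claim fails for G one loopless vertex and H, K infinite. *)

(* Defs.v *)
From mathcomp Require Import all_boot all_order all_algebra.
From mathcomp Require Import all_classical reals.

Set Implicit Arguments.
Unset Strict Implicit.
Unset Printing Implicit Defensive.

Import Order.TTheory GRing.Theory Num.Theory.
Local Open Scope classical_set_scope.
Local Open Scope ring_scope.

(** * Graphs *)

Record graph := Graph {
  vertex :> Type;
  edges : set (vertex * vertex);
  edges_sym : forall x y, edges (x, y) -> edges (y, x) }.

Section DirectProduct.
Variables H K : graph.

Definition dprod_edges : set ((H * K) * (H * K)) :=
  [set e | edges (e.1.1, e.2.1) /\ edges (e.1.2, e.2.2)].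

Lemma dprod_edges_sym p q : dprod_edges (p, q) -> dprod_edges (q, p).
Proof. by case=> /edges_sym eH /edges_sym eK; split. Qed.

Definition direct_product := Graph dprod_edges_sym.

End DirectProduct.

(** * Polyhedral complexes

A complex is given by its cells and the relation "[s] is contained in the
closure of [t]".  A polyhedral complex is a regular CW complex, hence is
determined up to cell-preserving homeomorphism by this poset.  There is no
empty cell. *)

Record cell_complex := CellComplex {
  cell :> Type;
  face : cell -> cell -> Prop }.

Section Polytopes.
Variable R : realType.

Definition conv_hull n m (v : 'I_m -> 'rV[R]_n) : set 'rV[R]_n :=
  [set x | exists c : 'I_m -> R,
     [/\ forall i, 0 <= c i, \sum_i c i = 1 & x = \sum_i c i *: v i]].

(* The nonempty faces of P, with P itself among them (u = 0). *)
Definition polytope_face n (P F : set 'rV[R]_n) : Prop :=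
  F !=set0 /\
  exists u : 'cV[R]_n,
    F = [set x | P x /\ forall y, P y -> (y *m u) 0 0 <= (x *m u) 0 0].

(* The closed cell t is a convex polytope, subdivided into its faces. *)
Definition polytopal (X : cell_complex) (t : X) : Prop :=
  exists n m (v : 'I_m -> 'rV[R]_n) (phi : X -> set 'rV[R]_n),
    set_bij [set s | face s t] [set F | polytope_face (conv_hull v) F] phi /\
    forall s s', face s t -> face s' t -> (face s s' <-> phi s `<=` phi s').

Definition polyhedral (X : cell_complex) : Prop :=
  [/\ forall s : X, face s s,
      forall s t : X, face s t -> face t s -> s = t,
      forall s t r : X, face s t -> face t r -> face s r
    & forall t : X, polytopal t].

End Polytopes.

Definition finite_complex (X : cell_complex) : Prop := finite_set [set: X].

(* The cells of the product are the products s x s' of cells. *)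
Definition complex_prod (X Y : cell_complex) : cell_complex :=
  @CellComplex (X * Y)%type (fun p q => face p.1 q.1 /\ face p.2 q.2).

(** * Simple homotopy equivalence *)

(* f identifies Y with the collection A of cells of X. *)
Definition cell_iso_onto (Y X : cell_complex) (A : set X) (f : Y -> X) : Prop :=
  set_bij [set: Y] A f /\ forall a b : Y, face a b <-> face (f a) (f b).

Definition isomorphic (Y X : cell_complex) : Prop :=
  exists f : Y -> X, cell_iso_onto [set: X] f.

(* Y is obtained from X by removing a cell t together with a free face s of t:
   s is in the boundary of t and of no other cell.  In a polyhedral complex
   this makes t maximal, s a facet of t, and Y a subcomplex. *)
Definition elementary_collapse (X Y : cell_complex) : Prop :=
  exists s t : X,
    [/\ s <> t, face s t, forall r, face s r -> r = s \/ r = t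
      & exists f : Y -> X, cell_iso_onto [set r | r <> s /\ r <> t] f].

(* Whitehead's formal deformations: finite sequences of elementary collapses
   and elementary expansions between finite polyhedral complexes, considered
   up to cellular isomorphism. *)
Inductive simple_homotopy_equivalent (R : realType) (X : cell_complex) :
    cell_complex -> Prop :=
| She_iso Y : finite_complex X -> polyhedral R X ->
    finite_complex Y -> polyhedral R Y -> isomorphic X Y ->
    simple_homotopy_equivalent R X Y
| She_collapse Y Z : simple_homotopy_equivalent R X Y ->
    finite_complex Z -> polyhedral R Z -> elementary_collapse Y Z ->
    simple_homotopy_equivalent R X Z
| She_expansion Y Z : simple_homotopy_equivalent R X Y ->
    finite_complex Z -> polyhedral R Z -> elementary_collapse Z Y ->
    simple_homotopy_equivalent R X Z.

(** * Hom complexes *)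

Definition multihom (T G : graph) (eta : T -> set G) : Prop :=
  [/\ forall x, eta x !=set0,
      forall x, finite_set (eta x),
      finite_set [set x | exists a b, [/\ eta x a, eta x b & a <> b]]
    & forall x y, edges (x, y) -> eta x `*` eta y `<=` edges (g := G)].

(* The cell eta stands for the product over x of the simplices on the vertex
   sets eta x. *)
Definition Hom_complex (T G : graph) : cell_complex :=
  @CellComplex {eta : T -> set G | multihom eta}
    (fun eta eta' => forall x, sval eta x `<=` sval eta' x).

(* Main.v *)
(** Put [A = Hom(G, H x K)] and [B = Hom(G, H) x Hom(G, K)].  Taking projections
    and taking products are adjoint monotone maps between the cells of [A] and of
    [B]: [proj a <= b] if and only if [a <= times b].  Consider the polytopal
    complex whose cells are those of [A], those of [B], and the joins [a * b] for
    which some cell [c] of [B] satisfies [a <= times c] and [b <= c].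

    It collapses onto [A]: process the cells [b] from the largest to the smallest.
    The cells [a] linked to [b] form a complex which with each [a] contains an
    upper bound of [a] and [times b], hence one of [a] and a fixed vertex [v] of
    [times b].  Such a complex of products of simplices collapses onto [v],
    coordinate by coordinate, by matching cells that differ in whether [v i]
    belongs to coordinate [i]; joining these collapses with [b], and finally
    removing [b] with [v * b], eliminates [b].  By the same argument, with
    [proj a] in place of [times b], it collapses onto [B]. *)

Require Import Defs.
From mathcomp Require Import all_boot all_order all_algebra.
From mathcomp Require Import all_classical reals.

Set Implicit Arguments.
Unset Strict Implicit.
Unset Printing Implicit Defensive.

Import Order.TTheory GRing.Theory Num.Theory.
Local Open Scope classical_set_scope.

(** * Finite sets and induction over them *)

Lemma finite_enum (T : Type) (A : set T) : finite_set A ->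
  exists (n : nat) (e : 'I_n -> T), injective e /\ forall x, A x <-> exists i, x = e i.
Proof.
case=> n /card_set_bijP [f [fA finj fsurj]].
have /choice [e eP] : forall i : 'I_n, exists x, A x /\ f x = i.
  by move=> i; have [x Ax fx] := fsurj i (ltn_ord i); exists x.
exists n, e; split=> [i j eij|x].
  by apply: val_inj; rewrite /= -(eP i).2 -(eP j).2 eij.
split=> [Ax|[i ->]]; last exact: (eP i).1.
exists (Ordinal (fA x Ax)); apply: finj; rewrite ?inE //; first exact: (eP _).1.
by rewrite (eP _).2.
Qed.

Lemma finite_complex_inj (X Y : cell_complex) (f : X -> Y) :
  injective f -> finite_complex Y -> finite_complex X.
Proof.
move=> fi fY; rewrite /finite_complex -(preimage_setT f).
by apply: finite_preimage => // a b _ _; apply: fi.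
Qed.

(** Strong induction on the number of elements of [S], counted along an enumeration of [X]. *)
Lemma finite_proper_ind (X : Type) (Q : set X -> Prop) :
  finite_set [set: X] ->
  (forall S, (forall S', S' `<` S -> Q S') -> Q S) -> forall S, Q S.
Proof.
move=> /finite_enum [n [e [_ eX]]] IH S.
pose c (S : set X) := #|[pred i : 'I_n | `[< S (e i) >]]|.
have [m] := ubnP (c S); elim: m S => // m IHm S Sm.
apply: IH => S' S'S; apply: IHm; apply: leq_trans (ltnSE Sm).
apply: proper_card; apply/properP; split.
  apply/fintype.subsetP => i; rewrite !inE.
  by case: S'S => + _; apply.
have [_ /existsNP [x /not_implyP [Sx S'x]]] := S'S.
have [i xi] := (eX x).1 I; exists i; subst x; first exact/asboolP.
by apply/negP => /asboolP.
Qed.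

(** * Subcomplexes and isomorphisms of cell complexes *)

Definition lower (X : cell_complex) (P : set X) : Prop :=
  forall c d : X, face c d -> P d -> P c.

Definition subcomplex (X : cell_complex) (P : set X) : cell_complex :=
  @CellComplex {c | P c} (fun c d => face (sval c) (sval d)).

Lemma sval_inj (T : Type) (P : T -> Prop) : injective (@proj1_sig T P).
Proof. by move=> [a Pa] [b Pb] /= ab; exact: eq_exist. Qed.

(** Being polytopal concerns only the closure of a cell, and since the image of [f] is lower, the
    closures of [t] and [f t] correspond. *)
Lemma polyhedral_embed (R : realType) (X Y : cell_complex) (f : X -> Y) :
  injective f -> (forall a b : X, face a b <-> face (f a) (f b)) ->
  lower [set f a | a in [set: X]] -> polyhedral R Y -> polyhedral R X.
Proof.
move=> fi fP flow [rY aY tY pY]; split.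
- by move=> s; apply/fP; exact: rY.
- by move=> s t /fP st /fP ts; apply: fi; exact: aY.
- by move=> s t r /fP st /fP tr; apply/fP; exact: tY tr.
move=> t; have [n [m [v [phi [phiB phiP]]]]] := pY (f t).
exists n, m, v, (phi \o f); split.
  apply: set_bij_comp phiB; split.
  - by move=> s /= /fP.
  - by move=> s s' _ _; exact: fi.
  - move=> s /= sft; have [a _ as_] := flow s (f t) sft (ex_intro2 _ _ t I erefl).
    by exists a => //=; apply/fP; rewrite as_.
by move=> s s' /fP st /fP s't; rewrite fP; exact: phiP.
Qed.

Lemma polyhedral_sub (R : realType) (X : cell_complex) (P : set X) :
  lower P -> polyhedral R X -> polyhedral R (subcomplex P).
Proof.
move=> Plow; apply: (@polyhedral_embed R (subcomplex P) X (@proj1_sig X P)) => //.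
  exact: sval_inj.
by move=> c d cd [[d' Pd] _ /= dd]; subst d'; exists (exist _ c (Plow c d cd Pd)).
Qed.

Lemma finite_sub (X : cell_complex) (P : set X) :
  finite_complex X -> finite_complex (subcomplex P).
Proof. by apply: (@finite_complex_inj (subcomplex P) X (@proj1_sig X P)); exact: sval_inj. Qed.

Lemma cell_iso_onto_comp (X Y Z : cell_complex) (A : set Y) (f : Y -> Z) (g : X -> Y) :
  cell_iso_onto [set: Z] f -> cell_iso_onto A g ->
  cell_iso_onto [set f a | a in A] (f \o g).
Proof.
move=> [[_ fi _] fP] [[gA gi gs] gP]; split; last first.
  by move=> a b; rewrite gP fP.
split.
- by move=> x _ /=; exists (g x) => //; exact: gA.
- by move=> x y _ _ /= fxy; apply: gi; rewrite ?inE //; apply: fi; rewrite ?inE.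
by move=> _ [y Ay <-]; have [x _ <-] := gs y Ay; exists x.
Qed.

Lemma isomorphic_trans (X Y Z : cell_complex) :
  isomorphic X Y -> isomorphic Y Z -> isomorphic X Z.
Proof.
move=> [g gI] [f fI]; exists (f \o g).
rewrite (_ : [set: Z] = [set f y | y in [set: Y]]).
  exact: cell_iso_onto_comp fI gI.
by case: fI => [[_ _ fs] _]; apply/seteqP; split.
Qed.

Lemma isomorphic_sym (X Y : cell_complex) : isomorphic X Y -> isomorphic Y X.
Proof.
move=> [f [[_ fi fs] fP]].
have /choice [g gP] : forall y, exists x, f x = y.
  by move=> y; have [x _ fx] := fs y I; exists x.
exists g; split; last by move=> a b; rewrite fP !gP.
split=> //.
  by move=> a b _ _ gab; rewrite -(gP a) -(gP b) gab.
by move=> x _; exists (f x) => //; apply: fi; rewrite ?inE ?gP.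
Qed.

Lemma elementary_collapse_iso_l (X Y Z : cell_complex) :
  isomorphic X Z -> elementary_collapse X Y -> elementary_collapse Z Y.
Proof.
move=> [f fI] [s [t [st fst fr [g gI]]]].
have [[_ fi fs] fP] := fI.
have fi' a b : f a = f b -> a = b by apply: fi; rewrite ?inE.
exists (f s), (f t); split.
- by move=> /fi'.
- exact/fP.
- move=> r; have [x _ <-] := fs r I; move=> /fP /fr [->|->]; by [left|right].
exists (f \o g).
rewrite (_ : mkset _ = [set f r | r in [set r | r <> s /\ r <> t]]).
  exact: cell_iso_onto_comp fI gI.
apply/seteqP; split; last by move=> _ [x [xs xt] <-]; split=> /fi'.
move=> z [zs zt]; have [x _ xz] := fs z I; subst z; exists x => //.
by split=> xE; [apply: zs|apply: zt]; rewrite xE.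
Qed.

Lemma elementary_collapse_iso_r (X Y Z : cell_complex) :
  isomorphic Y Z -> elementary_collapse X Y -> elementary_collapse X Z.
Proof.
move=> /isomorphic_sym [f fI] [s [t [st fst fr [g gI]]]].
exists s, t; split=> //; exists (g \o f).
case: fI => [[_ fi fs] fP]; case: gI => [[gA gi gs] gP]; split; last first.
  by move=> a b; rewrite fP gP.
split.
- by move=> z _ /=; exact: gA.
- by move=> x y _ _ /= gxy; apply: fi; rewrite ?inE //; apply: gi; rewrite ?inE.
move=> x /gs [y _ <-]; have [z _ <-] := fs y I; by exists z.
Qed.

(** Isomorphisms occur only at the start of a deformation, so a final one is absorbed into the last
    step. *)
Lemma she_iso_r (R : realType) (X Y Z : cell_complex) :
  isomorphic Y Z -> finite_complex Z -> polyhedral R Z ->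
  simple_homotopy_equivalent R X Y -> simple_homotopy_equivalent R X Z.
Proof.
move=> + fZ pZ XY; case: XY => {}Y.
- move=> fX pX _ _ XY YZ; apply: She_iso => //; exact: isomorphic_trans YZ.
- move=> W XY _ _ YW WZ; apply: (She_collapse XY) => //.
  exact: elementary_collapse_iso_r YW.
- move=> W XY _ _ WY WZ; apply: (She_expansion XY) => //.
  exact: elementary_collapse_iso_l WY.
Qed.

(** * Sequences of collapses inside one ambient complex *)

(** Working with sets of cells of a fixed complex avoids nested subtypes and lets intermediate
    stages be rewritten by set equalities. *)
Inductive collapses (X : cell_complex) : set X -> set X -> Prop :=
| collapses_refl P : collapses P P
| collapses_step (P Q : set X) (s t : X) :
    P s -> P t -> s <> t -> face s t ->
    (forall r, P r -> face s r -> r = s \/ r = t) ->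
    collapses (P `\` [set s; t]) Q -> collapses P Q.

Lemma collapses_trans (X : cell_complex) (P Q S : set X) :
  collapses P Q -> collapses Q S -> collapses P S.
Proof.
elim=> // {}P {}Q s t Ps Pt st fst fr _ IH QS.
by apply: (collapses_step Ps Pt st fst fr); exact: IH.
Qed.

(** Whatever contains [t] contains [s], so no remaining cell of [P] has [s] or [t] in its
    closure. *)
Lemma lower_collapse (X : cell_complex) (P : set X) (s t : X) :
  (forall a b c : X, face a b -> face b c -> face a c) ->
  lower P -> face s t -> (forall r, P r -> face s r -> r = s \/ r = t) ->
  lower (P `\` [set s; t]).
Proof.
move=> tr Plow st fr c d cd [Pd /= dst]; split; first exact: Plow Pd.
by move=> [E|E]; apply: dst; apply: fr => //; subst c => //; exact: tr cd.
Qed.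

Lemma elementary_collapse_sub (X : cell_complex) (P : set X) (s t : X) :
  P s -> P t -> s <> t -> face s t ->
  (forall r, P r -> face s r -> r = s \/ r = t) ->
  elementary_collapse (subcomplex P) (subcomplex (P `\` [set s; t])).
Proof.
move=> Ps Pt st fst fr; exists (exist _ s Ps), (exist _ t Pt); split=> //.
- by move=> [].
- by move=> [r Pr] /= /(fr r Pr) [E|E]; [left|right]; exact: eq_exist.
exists (fun c => exist P (sval c) (proj1 (svalP c))); split=> //; split.
- by move=> [c [Pc cst]] _ /=; split=> -[E]; apply: cst; [left|right].
- by move=> [c Pc] [d Pd] _ _ [cd]; exact: eq_exist.
move=> [c Pc] [/= cs ct].
have Pc' : (P `\` [set s; t]) c.
  by split=> // -[E|E]; [apply: cs|apply: ct]; exact: eq_exist.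
by exists (exist _ c Pc') => //; exact: eq_exist.
Qed.

Lemma she_collapses (R : realType) (W X : cell_complex) (P Q : set X) :
  finite_complex X -> polyhedral R X -> lower P -> collapses P Q ->
  simple_homotopy_equivalent R W (subcomplex P) ->
  simple_homotopy_equivalent R W (subcomplex Q).
Proof.
move=> fX pX + PQ; elim: PQ => // {}P {}Q s t Ps Pt st fst fr _ IH Plow WP.
have [_ _ tr _] := pX; have low' := lower_collapse tr Plow fst fr.
apply: IH => //; apply: (She_collapse WP).
- exact: finite_sub.
- exact: polyhedral_sub.
exact: elementary_collapse_sub.
Qed.

Lemma she_expands (R : realType) (W X : cell_complex) (P Q : set X) :
  finite_complex X -> polyhedral R X -> lower P -> collapses P Q ->
  simple_homotopy_equivalent R W (subcomplex Q) ->
  simple_homotopy_equivalent R W (subcomplex P).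
Proof.
move=> fX pX + PQ; elim: PQ => // {}P {}Q s t Ps Pt st fst fr _ IH Plow WQ.
have [_ _ tr _] := pX; have low' := lower_collapse tr Plow fst fr.
apply: (She_expansion (IH low' WQ)).
- exact: finite_sub.
- exact: polyhedral_sub.
exact: elementary_collapse_sub.
Qed.

(** * Collapses from closure operators; complexes of products of simplices *)

Definition poset (X : cell_complex) : Prop :=
  [/\ forall s : X, face s s,
      forall s t : X, face s t -> face t s -> s = t
    & forall s t r : X, face s t -> face t r -> face s r].

Lemma ex_maximal (X : cell_complex) (F : set X) (a : X) :
  finite_complex X -> poset X -> F a ->
  exists b : X, [/\ F b, face a b & forall c, F c -> face b c -> c = b].
Proof.
move=> fX [rX aX tX]; suff H S : forall a, F a -> S = [set c | face a c] ->
    exists b : X, [/\ F b, face a b & forall c, F c -> face b c -> c = b].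
  by move=> Fa; exact: (H _ a Fa erefl).
(* The induction is on the set [S] of cells above [a], which shrinks strictly when [a] is replaced
   by a larger cell. *)
pattern S; move: S; apply: (finite_proper_ind fX) => S IH {}a Fa SE.
have [amax|/existsNP [b /not_implyP [Fb /not_implyP [ab ba]]]] :=
  pselect (forall c, F c -> face a c -> c = a); first by exists a.
have [|c [Fc bc cmax]] := IH [set c | face b c] _ b Fb erefl.
  rewrite SE; split; first by move=> c; exact: tX.
  by move=> /(_ a (rX a)) /= /aX /(_ ab).
by exists c; split=> //; exact: tX bc.
Qed.

(* The fiber of [u] over a maximal cell of [F] is a free pair. *)
Lemma collapses_closure (X : cell_complex) (u : X -> X) (F P : set X) :
  finite_complex X -> poset X -> F `<=` P ->
  (forall c r, F c -> P r -> face c r -> F r) ->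
  (forall c, F c -> [/\ F (u c), face c (u c) & u (u c) = u c]) ->
  (forall c d, F c -> F d -> face c d -> face (u c) (u d)) ->
  (forall c, F c -> exists s, [/\ F s, s <> u c, u s = u c &
     forall r, F r -> u r = u c -> r = s \/ r = u c]) ->
  collapses P (P `\` F).
Proof.
move=> fX pX; have [rX aX tX] := pX; move: P.
pattern F; move: F; apply: (finite_proper_ind fX) => F IH P FP Fup uF umono u2.
have [->|/eqP/set0P [x Fx]] := pselect (F = set0).
  by rewrite setD0; exact: collapses_refl.
have [a [Fa _ amax]] := ex_maximal fX pX Fx.
(* Maximality makes [a] a fixed point of [u], hence the top of its fiber. *)
have ua : u a = a by have [Fua aua _] := uF a Fa; exact: amax.
have [s [Fs sua us fib]] := u2 a Fa; rewrite ua in sua us fib.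
have sa : face s a by have [_ + _] := uF s Fs; rewrite us.
(* By monotonicity [u r] lies above [u s], which is the maximal cell [a]; so [r] belongs to the
   fiber over [a]. *)
have freeF r : F r -> face s r -> r = s \/ r = a.
  move=> Fr sr; apply: fib => //; have [Fur rur _] := uF r Fr.
  by apply: amax => //; rewrite -us; exact: umono.
have free r : P r -> face s r -> r = s \/ r = a.
  by move=> Pr sr; apply: freeF => //; exact: Fup sr.
have uN r : F r -> r <> s -> r <> a -> u r <> s /\ u r <> a.
  move=> Fr rs ra; have [Fur rur uur] := uF r Fr; split=> urE; last by case: (fib r Fr urE).
  by apply: sua; rewrite -us -urE uur.
apply: (collapses_step (FP _ Fs) (FP _ Fa) sua sa free).
have -> : P `\` F = (P `\` [set s; a]) `\` (F `\` [set s; a]).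
  apply/seteqP; split=> [r [Pr nFr]|r [[Pr rsa] nFr]].
    by split; [split=> // -[E|E]; apply: nFr; rewrite E|case].
  by split=> // Fr; apply: nFr.
apply: IH.
- by split; [exact: subDsetl|move=> /(_ a Fa) [_]; apply; right].
- by move=> r [Fr rsa]; split=> //; exact: FP.
- by move=> c r [Fc _] [Pr rsa] cr; split=> //; exact: Fup cr.
- move=> c [Fc csa]; have [Fuc cuc uuc] := uF c Fc; split=> //; split=> //.
  have [] := uN c Fc; first by move=> E; apply: csa; left.
    by move=> E; apply: csa; right.
  by move=> us' ua' [].
- by move=> c d [Fc _] [Fd _]; exact: umono.
(* The partner [w] of [c] survives: were it [s] or [a], then [c] would lie in the removed fiber as
   well. *)
move=> c [Fc csa]; have [w [Fw wu uw wfib]] := u2 c Fc; exists w; split=> //.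
  split=> // wsa.
  have uwa : u w = a by case: wsa => ->.
  have [_ _ cN] := uF c Fc; apply: csa.
  by apply: fib => //; rewrite -uw.
by move=> r [Fr _]; exact: wfib.
Qed.

(* Complexes of products of simplices: the cell [a] is the product over [i] of
   the simplices on the vertex sets [iota a i]. *)
Record box (X : cell_complex) (I V : Type) (iota : X -> I -> set V) : Prop := Box {
  box_face : forall a b : X, face a b <-> forall i, iota a i `<=` iota b i;
  box_inj : injective iota;
  box_neq0 : forall a i, iota a i !=set0;
  box_finite : forall a i, finite_set (iota a i);
  box_support : forall a,
    finite_set [set i | exists x y, [/\ iota a i x, iota a i y & x <> y]];
  box_sub : forall a (phi : I -> set V), (forall i, phi i !=set0) ->
    (forall i, phi i `<=` iota a i) -> exists b, iota b = phi }.

Lemma box_ext (X : cell_complex) (I V : Type) (iota : X -> I -> set V) (a b : X) :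
  box iota -> (forall i x, iota a i x <-> iota b i x) -> a = b.
Proof.
move=> bX ab; apply: (box_inj bX); apply: funext => i.
by apply/seteqP; split=> x /ab.
Qed.

Lemma box_poset (X : cell_complex) (I V : Type) (iota : X -> I -> set V) :
  box iota -> poset X.
Proof.
move=> bX; split.
- by move=> s; apply/(box_face bX) => i x.
- move=> s t /(box_face bX) st /(box_face bX) ts.
  by apply: (box_ext bX) => i x; split; [exact: st|exact: ts].
- move=> s t r /(box_face bX) st /(box_face bX) tr.
  by apply/(box_face bX) => i x /st /tr.
Qed.

(** Fix a coordinate [i] in which some cell of [S] differs from [[set v0 i]]. Adding [v0 i] to
    coordinate [i] is a closure operator on all such cells, and its fibers are pairs that differ in
    [v0 i] only. Removing them leaves a smaller complex of the same kind. *)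
Lemma collapses_cone (X : cell_complex) (I V : Type) (iota : X -> I -> set V)
    (v : X) (v0 : I -> V) (S : set X) :
  finite_complex X -> box iota -> iota v = (fun i => [set v0 i]) ->
  lower S -> S v -> (forall a, S a -> exists c, [/\ S c, face a c & face v c]) ->
  collapses S [set v].
Proof.
move=> fX bX vE; have pX := box_poset bX; have [rX aX tX] := pX.
pattern S; move: S; apply: (finite_proper_ind fX) => S IH Slow Sv Scone.
have [->|Snv] := pselect (S = [set v]); first exact: collapses_refl.
have [Sv'|/existsNP [c /not_implyP [Sc cv]]] := pselect (forall c, S c -> c = v).
  by case: Snv; apply/seteqP; split=> // c ->.
have [i civ] : exists i, iota c i <> [set v0 i].
  apply/existsNP => H; apply: cv; apply: (box_inj bX); rewrite vE.
  exact: funext.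
(* A cell of [S] above both [a] and [v] contains every product whose coordinates lie in those of [a]
   enlarged by [v0], and [S] is lower. *)
have joinS a phi : S a -> (forall j, phi j !=set0) ->
    (forall j x, phi j x -> iota a j x \/ x = v0 j) -> exists d, S d /\ iota d = phi.
  move=> Sa phi0 phia; have [d [Sd /(box_face bX) ad /(box_face bX) vd]] := Scone a Sa.
  have [|e eE] := box_sub bX (a := d) phi0.
    by move=> j x /phia [/ad//|->]; apply: vd; rewrite vE.
  exists e; split=> //; apply: Slow Sd; apply/(box_face bX) => j x; rewrite eE.
  by move=> /phia [/ad//|->]; apply: vd; rewrite vE.
have vert d r : face d r -> iota r i = [set v0 i] -> iota d i = [set v0 i].
  move=> /(box_face bX)/(_ i) dr rv; apply/seteqP; split; first by rewrite -rv.
  by have [x dx] := box_neq0 bX d i; move=> _ ->; have := dr x dx; rewrite rv => <-.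
pose F := [set d | S d /\ iota d i <> [set v0 i]].
have /choice [u uP] : forall d, exists e, S d ->
    S e /\ iota e = fun j => iota d j `|` [set x | j = i /\ x = v0 i].
  move=> d; have [Sd|nSd] := pselect (S d); last by exists d.
  have [||e eP] := joinS d (fun j => iota d j `|` [set x | j = i /\ x = v0 i]) Sd.
  - by move=> j; have [x dx] := box_neq0 bX d j; exists x; left.
  - by move=> j x [|[-> ->]]; [left|right].
  by exists e.
have uE d j x : S d -> iota (u d) j x <-> iota d j x \/ (j = i /\ x = v0 i).
  by move=> Sd; rewrite (uP d Sd).2.
have du d : S d -> face d (u d).
  by move=> Sd; apply/(box_face bX) => j x dx; apply/uE => //; left.
have Fup d r : F d -> S r -> face d r -> F r.
  by move=> [Sd dv] Sr dr; split=> // /(vert _ _ dr).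
have SuF d : F d -> F (u d).
  by move=> Fd; have [Sd _] := Fd; apply: Fup (du d Sd) => //; exact: (uP d Sd).1.
have SF : collapses S (S `\` F).
  apply: (@collapses_closure X u) => //.
  - by move=> d [].
  - move=> d Fd; have [Sd _] := Fd; have [Sud _] := SuF d Fd.
    split; [exact: SuF|exact: du|].
    by apply: (box_ext bX) => j x; rewrite !uE //; tauto.
  - move=> d e [Sd _] [Se _] /(box_face bX) de; apply/(box_face bX) => j x.
    by rewrite !uE // => -[/de|]; tauto.
  move=> d [Sd dv].
  (* The partner is the member of the fiber that omits [v0 i]; its coordinate [i] is nonempty
     because that of [d] is not [[set v0 i]]. *)
  have [||s [Ss sE]] := joinS d (fun j => iota d j `&` [set x | ~ (j = i /\ x = v0 i)]) Sd.
  - move=> j; have [x dx] := box_neq0 bX d j; have [ji|nji] := pselect (j = i); last first.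
      by exists x; split=> // -[].
    subst j; have [all|/existsNP [y /not_implyP [dy yv]]] :=
        pselect (forall y, iota d i y -> y = v0 i); last by exists y; split=> // -[].
    case: dv; apply/seteqP; split=> [y /all//|y ->].
    by rewrite -(all x dx).
  - by move=> j x [dx _]; left.
  have sP j x : iota s j x <-> iota d j x /\ ~ (j = i /\ x = v0 i) by rewrite sE.
  exists s; split.
  - split=> // sv; have : iota s i (v0 i) by rewrite sv.
    by move=> /sP [_]; apply.
  - move=> su; have : iota s i (v0 i) by rewrite su; apply/uE => //; right.
    by move=> /sP [_]; apply.
  - apply: (box_ext bX) => j x; rewrite !uE // sP.
    by have := EM (j = i /\ x = v0 i); tauto.
  move=> r [Sr rv] urd; have rd j x : iota r j x \/ (j = i /\ x = v0 i) <->
      iota d j x \/ (j = i /\ x = v0 i) by rewrite -!uE // urd.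
  have [riv|nriv] := pselect (iota r i (v0 i)); [right|left].
    apply: (box_ext bX) => j x; rewrite uE // -rd; split; first by left.
    by move=> [//|[-> ->]].
  apply: (box_ext bX) => j x; rewrite sP; have := rd j x.
  have : iota r j x -> ~ (j = i /\ x = v0 i) by move=> + [ji xv]; rewrite ji xv.
  tauto.
apply: (collapses_trans SF); apply: IH.
- split; first exact: subDsetl.
  by move=> /(_ c Sc) [_]; apply; split.
- move=> d e de [Se nFe]; have Sd := Slow d e de Se; split=> // Fd.
  by apply: nFe; exact: Fup de.
- by split=> // -[_]; rewrite vE.
move=> a [Sa nFa].
(* Enlarging [a] by [v0] in every coordinate does not lead into [F], since coordinate [i] of [a] is
   already [[set v0 i]]. *)
have [||e [Se eE]] := joinS a (fun j => iota a j `|` [set v0 j]) Sa.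
- by move=> j; exists (v0 j); right.
- by move=> j x.
exists e; split.
- split=> // -[_]; apply; rewrite eE.
  have [aiv|nai] := pselect (iota a i = [set v0 i]); first by rewrite aiv setUid.
  by case: nFa.
- by apply/(box_face bX) => j x; rewrite eE; left.
- by apply/(box_face bX) => j x; rewrite eE vE; right.
Qed.

(** * Joins, and the collapse of linked pairs of cells onto one side *)

Inductive join_cell (X Y : cell_complex) : Type :=
| JoinL of X
| JoinR of Y
| JoinB of X & Y.
Arguments JoinL {X Y}.
Arguments JoinR {X Y}.

(** [None] is the empty cell, contained in every cell. A cell of a join amounts to a pair of
    optional cells, not both empty. *)
Definition oface (X : cell_complex) (a b : option X) : Prop :=
  match a, b with
  | None, _ => True
  | Some _, None => False
  | Some a, Some b => face a b
  end.

Definition join_left (X Y : cell_complex) (m : join_cell X Y) : option X :=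
  match m with JoinL a | JoinB a _ => Some a | JoinR _ => None end.

Definition join_right (X Y : cell_complex) (m : join_cell X Y) : option Y :=
  match m with JoinR b | JoinB _ b => Some b | JoinL _ => None end.

Definition join_complex (X Y : cell_complex) : cell_complex :=
  @CellComplex (join_cell X Y) (fun m m' =>
    oface (join_left m) (join_left m') /\ oface (join_right m) (join_right m')).

Definition linked (X Y : cell_complex) (rel : X -> Y -> Prop) :
    set (join_complex X Y) :=
  fun m => if m is JoinB a b then rel a b else True.

Lemma linked_lower (X Y : cell_complex) (rel : X -> Y -> Prop) :
  (forall a a' b b', face a a' -> face b b' -> rel a' b' -> rel a b) ->
  lower (linked rel).
Proof. by move=> rl [a|b|a b] [a'|b'|a' b'] //= [] // aa' bb'; exact: rl. Qed.

Lemma box_vertex (X : cell_complex) (I V : Type) (iota : X -> I -> set V) (w : X) :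
  box iota -> exists v v0, iota v = (fun i => [set v0 i]) /\ face v w.
Proof.
move=> bX; have /choice [v0 v0w] : forall i, exists x, iota w i x.
  exact: box_neq0 bX w.
have [||v vE] := box_sub bX (a := w) (phi := fun i => [set v0 i]).
- by move=> i; exists (v0 i).
- by move=> i _ ->.
by exists v, v0; split=> //; apply/(box_face bX) => i; rewrite vE => _ ->.
Qed.

(** The remaining cells of [Y] are eliminated one maximal cell [b] at a time. By the hypothesis on
    [w], any vertex [v] of [w] is a cone point for the cells linked to [b], so the joins with [b]
    collapse to [JoinB v b], which leaves together with [JoinR b]. *)
Lemma collapses_linked (X Y : cell_complex) (I V : Type) (iota : X -> I -> set V)
    (rel : X -> Y -> Prop) :
  finite_complex X -> finite_complex Y -> box iota -> poset Y ->
  (forall a a' b b', face a a' -> face b b' -> rel a' b' -> rel a b) ->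
  (forall b, exists w, rel w b /\
     forall a, rel a b -> exists c, [/\ rel c b, face a c & face w c]) ->
  collapses (linked rel) [set JoinL a | a in [set: X]].
Proof.
move=> fX fY bX pY rl cone; have [rX aX tX] := box_poset bX; have [rY aY tY] := pY.
(* [P U] is the stage at which exactly the cells of [Y] in [U] remain. *)
pose P (U : set Y) : set (join_complex X Y) := fun m =>
  match m with JoinL _ => True | JoinR d => U d | JoinB c d => U d /\ rel c d end.
have -> : linked rel = P setT.
  by apply/seteqP; split=> -[a|b|a b] //= [].
have -> : [set JoinL a | a in [set: X]] = P set0.
  apply/seteqP; split; first by move=> _ [a _ <-].
  by move=> [a|b|a b] //=; [exists a|case].
suff: forall U : set Y, lower U -> collapses (P U) (P set0) by apply=> c d.
apply: (finite_proper_ind fY) => U IH Ulow.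
have [->|/eqP/set0P [y Uy]] := pselect (U = set0); first exact: collapses_refl.
have [b [Ub _ bmax]] := ex_maximal fY pY Uy.
have [w [wb wcone]] := cone b.
have [v [v0 [vE vw]]] := box_vertex w bX.
have Sv : collapses [set a | rel a b] [set v].
  apply: (collapses_cone fX bX vE).
  - by move=> c d cd; exact: rl.
  - exact: rl wb.
  - by move=> a /wcone [c [cb ac wc]]; exists c; split=> //; exact: tX wc.
(* While [b] is being eliminated only the joins with [b] change: their left parts run through
   [S]. *)
pose T (S : set X) : set (join_complex X Y) := fun m =>
  match m with JoinL _ => True | JoinR d => U d
  | JoinB c d => [/\ U d, d <> b & rel c d] \/ (d = b /\ S c) end.
have -> : P U = T [set a | rel a b].
  apply/seteqP; split=> -[a|c|a c] //=.
    move=> [Uc ac]; have [cb|cb] := pselect (c = b); first by right; rewrite -cb.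
    by left.
  by move=> [[Uc _ ac]|[-> ac]].
(* Maximality of [b] in [U] leaves only joins with [b] above [JoinB s b], so freeness of [s] carries
   over. *)
have lift S S' : collapses S S' -> collapses (T S) (T S').
  elim=> [S1|S1 S2 s t Ss St st fst fr _ IHS]; first exact: collapses_refl.
  apply: (@collapses_step (join_complex X Y) _ _ (JoinB s b) (JoinB t b)); rewrite /T /=.
  - by right.
  - by right.
  - by case.
  - by split.
  - move=> [a|c|a c] //= + [] // sa bc.
    move=> [[Uc cb _]|[cb Sa]]; first by have := bmax c Uc bc.
    by subst c; have [->|->] := fr a Sa sa; [left|right].
  suff -> : T S1 `\` [set JoinB s b; JoinB t b] = T (S1 `\` [set s; t]) by [].
  apply/seteqP; split=> -[a|c|a c] //=.
  - by case.
  - move=> [[[Uc cb ac]|[cb Sa]] nst]; [by left|right]; split=> //; split=> //.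
    by move=> E; apply: nst; rewrite cb; case: E => ->; [left|right].
  - by split=> // -[].
  - by split=> // -[].
  move=> [[Uc cb ac]|[cb [Sa nst]]].
    by split; [left|move=> [] [_ /cb]].
  by split; [right|move=> [] [E _]; apply: nst; [left|right]].
apply: (collapses_trans (lift _ _ Sv)).
(* By now [JoinB v b] is the only other cell containing [JoinR b]. *)
apply: (@collapses_step (join_complex X Y) _ _ (JoinR b) (JoinB v b)); rewrite /T /=.
- by [].
- by right.
- by [].
- by split.
- move=> [a|c|a c] //= + [] // _ bc; first by move=> Uc; left; rewrite (bmax c Uc bc).
  move=> [[Uc cb _]|[cb ->]]; first by have := bmax c Uc bc.
  by right; rewrite cb.
suff -> : T [set v] `\` [set JoinR b; JoinB v b] = P (U `\` [set b]).
  apply: IH.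
    by split; [exact: subDsetl|move=> /(_ b Ub) [_]; apply].
  move=> c d cd [Ud db]; split; first exact: Ulow Ud.
  by move=> cb; apply: db; apply: bmax => //; rewrite -cb.
apply/seteqP; split=> -[a|c|a c] //=.
- by move=> [Uc nb]; split=> // cb; apply: nb; left; rewrite cb.
- move=> [[[Uc cb ac]|[-> ->]] nb]; first by split.
  by case: nb; right.
- by split=> // -[].
- by move=> [Uc cb]; split=> // -[] // [E]; apply: cb.
by move=> [[Uc cb] ac]; split; [left|move=> [] // [_ /cb]].
Qed.

(** * Realization of cells and joins as convex polytopes *)

Local Open Scope ring_scope.

Section WeightedAverage.
Variables (R : realType) (m : nat) (c d : 'I_m -> R) (mu : R).
Hypotheses (c_ge0 : forall i, 0 <= c i) (c_sum1 : \sum_i c i = 1).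

Lemma avg_eq : (forall i, c i != 0 -> d i = mu) -> \sum_i c i * d i = mu.
Proof.
move=> dmu; rewrite -[RHS]mul1r -c_sum1 mulr_suml; apply: eq_bigr => i _.
by have [->|/dmu ->//] := eqVneq (c i) 0; rewrite !mul0r.
Qed.

Hypothesis d_le : forall i, d i <= mu.

Lemma avg_le : \sum_i c i * d i <= mu.
Proof.
rewrite -[leRHS]mul1r -c_sum1 mulr_suml; apply: ler_sum => i _.
exact: ler_wpM2l.
Qed.

(** The terms [c i * (mu - d i)] are nonnegative and sum to zero, so each vanishes. This locates the
    support of a maximizing point. *)
Lemma avg_max : mu <= \sum_i c i * d i -> forall i, c i != 0 -> d i = mu.
Proof.
move=> mule i ci; have E : \sum_i c i * (mu - d i) = 0.
  under eq_bigr do rewrite mulrBr.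
  rewrite sumrB -mulr_suml c_sum1 mul1r; apply/eqP; rewrite subr_eq0 eq_le mule.
  exact: avg_le.
have ge0 j : 0 <= c j * (mu - d j) by rewrite mulr_ge0 ?subr_ge0.
have /eqP := psumr_eq0P (fun j _ => ge0 j) E (i := i) isT.
by rewrite mulf_eq0 (negbTE ci) /= subr_eq0 => /eqP.
Qed.

End WeightedAverage.

(** The value of the functional [u] at the generator [M j]. Arbitrary finite index types allow sums
    of types to index a join. *)
Definition pairing (R : realType) (J C : finType) (M : J -> C -> R)
  (u : C -> R) (j : J) : R := \sum_k M j k * u k.

(* Polytopes are handled through the cones over them: the generators [M j] lie
   on the hyperplane [h = 1], and the faces are the zero sets of the functionals
   that are nonpositive on all generators.  The join of two polytopes is then the
   product of their cones. *)
Lemma polytopal_cone (R : realType) (X : cell_complex) (t : X) (J C : finType)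
    (M : J -> C -> R) (h : C -> R) (psi : X -> J -> Prop) :
  (forall s s' : X, face s s' -> face s' s -> s = s') ->
  (forall j, pairing M h j = 1) ->
  (forall s, face s t -> exists j, psi s j) ->
  (forall s s', face s t -> face s' t ->
     (face s s' <-> forall j, psi s j -> psi s' j)) ->
  (forall u, (forall j, pairing M u j <= 0) -> (exists j, pairing M u j = 0) ->
     exists s, face s t /\ forall j, psi s j <-> pairing M u j = 0) ->
  (forall s, face s t -> exists u, (forall j, pairing M u j <= 0) /\
     forall j, psi s j <-> pairing M u j = 0) ->
  polytopal R t.
Proof.
move=> aX hM psi0 psi_le cut expose.
pose v (i : 'I_#|J|) : 'rV[R]_#|C| := \row_k M (enum_val i) (enum_val k).
pose d (U : 'cV[R]_#|C|) i := (v i *m U) 0 0.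
have dE U i : d U i = pairing M (fun k => U (enum_rank k) 0) (enum_val i).
  rewrite /d mxE (reindex (@enum_rank C)) /=; last exact/onW_bij/enum_rank_bij.
  by apply: eq_bigr => k _; rewrite mxE enum_rankK.
have combU U (c : 'I_#|J| -> R) : ((\sum_i c i *: v i) *m U) 0 0 = \sum_i c i * d U i.
  rewrite mulmx_suml summxE; apply: eq_bigr => i _.
  by rewrite -scalemxAl mxE.
(* The face belonging to [s] is the convex hull of the generators in [psi s]. *)
pose phi s : set 'rV[R]_#|C| := [set x | exists c : 'I_#|J| -> R,
   [/\ forall i, 0 <= c i, \sum_i c i = 1, x = \sum_i c i *: v i
     & forall i, c i != 0 -> psi s (enum_val i)]].
have phiv s j : psi s j -> phi s (v (enum_rank j)).
  move=> sj; exists (fun i => (i == enum_rank j)%:R); split.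
  - by move=> i; exact: ler0n.
  - by rewrite (bigD1 (enum_rank j)) //= eqxx big1 ?addr0 // => i /negbTE ->.
  - rewrite (bigD1 (enum_rank j)) //= eqxx scale1r big1 ?addr0 // => i /negbTE ->.
    by rewrite scale0r.
  by move=> i; have [->|] := eqVneq i; rewrite ?enum_rankK ?eqxx.
have convv i : conv_hull v (v i).
  exists (fun i' => (i' == i)%:R); split.
  - by move=> i'; exact: ler0n.
  - by rewrite (bigD1 i) //= eqxx big1 ?addr0 // => i' /negbTE ->.
  by rewrite (bigD1 i) //= eqxx scale1r big1 ?addr0 // => i' /negbTE ->; rewrite scale0r.
have exposeU s : face s t -> exists U, (forall i, d U i <= 0) /\
    forall i, psi s (enum_val i) <-> d U i = 0.
  move=> /expose [u [u0 uP]]; exists (\col_k u (enum_val k)).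
  have duE i : d (\col_k u (enum_val k)) i = pairing M u (enum_val i).
    by rewrite dE; apply: eq_bigr => k _; rewrite mxE enum_rankK.
  by split=> i; rewrite duE.
have phi_le s s' : face s t -> face s' t -> face s s' <-> phi s `<=` phi s'.
  move=> st s't; rewrite psi_le //; split.
    by move=> ss' x [c [c0 c1 xE cs]]; exists c; split=> // i /cs /ss'.
  (* The functional exposing [s'] vanishes on all of [phi s'], hence at the generator [j], which
     places [j] in [psi s']. *)
  move=> ss' j sj; have [c [c0 c1 vE cs']] := ss' _ (phiv s j sj).
  have [U [_ UP]] := exposeU s' s't; have := UP (enum_rank j); rewrite enum_rankK => ->.
  rewrite /d vE combU; apply: avg_eq => // i /cs'; exact: (UP i).1.
exists #|C|, #|J|, v, phi; split=> //; split.
- move=> s /= st; split; first by have [j /phiv] := psi0 s st; exists (v (enum_rank j)).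
  have [U [U0 UP]] := exposeU s st; exists U; apply/seteqP; split.
    move=> x [c [c0 c1 xE cs]]; split; first by exists c.
    move=> y [c' [c'0 c'1 ->]]; rewrite xE !combU.
    rewrite (_ : \sum_i c i * _ = 0); first exact: avg_le.
    by apply: avg_eq => // i /cs /UP.
  move=> x [[c [c0 c1 xE]] xmax]; exists c; split=> //.
  have [j sj] := psi0 s st; have := xmax _ (convv (enum_rank j)).
  have := (UP (enum_rank j)).1; rewrite enum_rankK => /(_ sj).
  rewrite /d => ->; rewrite xE combU => sum0 i ci; apply/UP.
  exact: (avg_max c0 c1 U0 sum0).
- move=> s s'; rewrite !inE => st s't ss'; apply: aX; apply/phi_le => //.
    by rewrite ss'.
  by rewrite ss'.
move=> F [[x0 Fx0] [U FE]].
(* [mu] is the maximum of [U] on the polytope. As [h] is 1 on every generator, subtracting [mu * h]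
   gives a linear functional that is nonpositive on the cone and vanishes exactly at the maximizing
   generators. *)
pose mu := (x0 *m U) 0 0.
have [[c0 [c0_ge0 c0_sum x0E]] x0max] : (conv_hull v x0) /\
    forall y, conv_hull v y -> (y *m U) 0 0 <= mu by rewrite FE in Fx0.
have dmu i : d U i <= mu by exact: x0max.
have uE j : pairing M (fun k => U (enum_rank k) 0 - mu * h k) j = d U (enum_rank j) - mu.
  rewrite /pairing; under eq_bigr do rewrite mulrBr mulrCA.
  by rewrite sumrB -mulr_sumr -/(pairing M h j) hM mulr1 dE enum_rankK.
have [||s [st sP]] := cut (fun k => U (enum_rank k) 0 - mu * h k).
- by move=> j; rewrite uE subr_le0.
- have [i ci] : exists i, c0 i != 0.
    apply: contrapT => /forallNP H; have := c0_sum; rewrite big1 => [/eqP|i _].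
      by rewrite eq_sym oner_eq0.
    by apply/eqP; have /negP := H i; rewrite negbK.
  exists (enum_val i); rewrite uE enum_valK; apply/eqP; rewrite subr_eq0; apply/eqP.
  apply: (avg_max c0_ge0 c0_sum dmu) => //.
  by rewrite -combU -x0E.
exists s => //; rewrite FE; have sd i : psi s (enum_val i) <-> d U i = mu.
  rewrite sP uE enum_valK; split=> [/eqP|->]; last by rewrite subrr.
  by rewrite subr_eq0 => /eqP.
apply/seteqP; split=> x.
  move=> [c [c_ge0 c1 xE cs]]; split; first by exists c.
  move=> y /x0max; rewrite xE combU (_ : \sum_i c i * _ = mu) //.
  by apply: avg_eq => // i /cs /sd.
move=> [[c [c_ge0 c1 xE]] xmax]; exists c; split=> // i ci; apply/sd.
apply: (avg_max c_ge0 c1 dmu) => //; rewrite -combU -xE; apply: xmax.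
by rewrite x0E; exists c0.
Qed.

(* [None] stands for the empty face, which exists in the cone but not in a cell
   complex. *)
Definition cone_rep (R : realType) (X : cell_complex) (t : option X) : Prop :=
  exists (J C : finType) (M : J -> C -> R) (h : C -> R) (psi : option X -> J -> Prop),
  [/\ forall j, pairing M h j = 1 /\ ~ psi None j,
      forall s s', oface s t -> oface s' t ->
        (oface s s' <-> forall j, psi s j -> psi s' j),
      forall u, (forall j, pairing M u j <= 0) ->
        exists s, oface s t /\ forall j, psi s j <-> pairing M u j = 0
    & forall s, oface s t -> exists u, (forall j, pairing M u j <= 0) /\
        forall j, psi s j <-> pairing M u j = 0].

(** The cone over the empty polytope is a point and has no generators. *)
Lemma cone_rep_none (R : realType) (X : cell_complex) : cone_rep R (@None X).
Proof.
exists void, void, (fun _ _ => 0), (fun _ => 0), (fun _ _ => False); split.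
- by case.
- by move=> [s|] [s'|].
- by move=> u _; exists None; split=> // -[].
by move=> s _; exists (fun _ => 0); split=> -[].
Qed.

(** Generators are the vertices of the product: choices of one vertex per nontrivial coordinate,
    encoded by a constant 1 and the indicators of the chosen vertices. A functional is then a
    constant plus a sum over coordinates, so its maximum is attained exactly where every summand is
    maximal, which is again a product. *)
Lemma cone_rep_box (R : realType) (X : cell_complex) (I V : Type)
    (iota : X -> I -> set V) (a : X) : box iota -> cone_rep R (Some a).
Proof.
move=> bX; pose D := [set i | exists x y, [/\ iota a i x, iota a i y & x <> y]].
have fD : finite_set D := box_support bX a.
(* [p] enumerates the finitely many coordinates with at least two vertices, and [q] all vertices
   occurring in them. *)
have [k [p [pI pD]]] := finite_enum fD.
have [l [q [qI qW]]] := finite_enum (bigcup_finite fD (fun i _ => box_finite bX a i)).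
pose J := {f : {ffun 'I_k -> 'I_l} | [forall j, `[< iota a (p j) (q (f j)) >]]}.
pose C := ('I_1 + 'I_k * 'I_l)%type.
pose M (f : J) (c : C) : R :=
  match c with inl _ => 1 | inr jy => (val f jy.1 == jy.2)%:R end.
pose psi (s : option X) (f : J) :=
  if s is Some b then forall j, iota b (p j) (q (val f j)) else False.
have ME u f : pairing M u f = u (inl ord0) + \sum_j u (inr (j, val f j)).
  rewrite /pairing big_sumType big_ord1 /= mul1r; congr (_ + _).
  transitivity (\sum_j \sum_y (val f j == y)%:R * u (inr (j, y))).
    by rewrite pair_bigA; apply: eq_bigr => -[].
  apply: eq_bigr => j _; rewrite (bigD1 (val f j)) //= eqxx mul1r big1 ?addr0 //.
  by move=> y; rewrite eq_sym => /negbTE ->; rewrite mul0r.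
have valid (f : J) j : iota a (p j) (q (val f j)).
  by have /forallP/(_ j)/asboolP := valP f.
have mk (g : 'I_k -> 'I_l) : (forall j, iota a (p j) (q (g j))) ->
    exists f : J, forall j, val f j = g j.
  move=> ga; have gP : [forall j, `[< iota a (p j) (q (finfun g j)) >]].
    by apply/forallP => j; rewrite ffunE; exact/asboolP.
  by exists (exist _ (finfun g) gP) => j; rewrite /= ffunE.
have label j x : iota a (p j) x -> exists y, x = q y.
  by move=> ax; apply/qW; exists (p j) => //; apply/pD; exists j.
have select b : face b a -> exists g, forall j, iota b (p j) (q (g j)).
  move=> /(box_face bX) ba.
  have /choice [g gb] : forall j, exists y, iota b (p j) (q y); last by exists g.
  move=> j; have [x bx] := box_neq0 bX b (p j).
  by have [y xy] := label j x (ba _ _ bx); exists y; rewrite -xy.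
have vertex b j0 y0 : face b a -> iota b (p j0) (q y0) ->
    exists f : J, psi (Some b) f /\ val f j0 = y0.
  move=> ba by0; have [g gb] := select b ba; move/(box_face bX) in ba.
  pose g' j := if j == j0 then y0 else g j.
  have g'b j : iota b (p j) (q (g' j)).
    by rewrite /g'; have [->|_] := eqVneq j j0.
  have [|f fE] := mk g'; first by move=> j; exact: ba.
  by exists f; split; [move=> j; rewrite fE|rewrite fE /g' eqxx].
have vertex' b : face b a -> exists f : J, psi (Some b) f.
  move=> ba; have [g gb] := select b ba; move/(box_face bX) in ba.
  have [|f fE] := mk g; first by move=> j; exact: ba.
  by exists f => j; rewrite fE.
exists J, C, M, (fun c => if c is inl _ then 1 else 0), psi; split.
- by move=> f; rewrite ME big1 ?addr0; split.
- move=> [b|] [b'|] //= ba b'a; last first.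
    by split=> // H; have [f /H] := vertex' b ba.
  split=> [/(box_face bX) bb' f fb j|H]; first exact: bb'.
  have bai := (box_face bX b a).1 ba; have b'ai := (box_face bX b' a).1 b'a.
  (* Outside [D] the coordinate of [a] is a single vertex, so [b] and [b'] agree there. *)
  apply/(box_face bX) => i x bx; have [/pD [j ij]|nDi] := pselect (D i).
    subst i; have [y xy] := label j x (bai _ _ bx); subst x.
    by have [f [/H fb' <-]] := vertex b j y ba bx.
  have [x' b'x'] := box_neq0 bX b' i.
  suff -> : x = x' by [].
  apply: contrapT => xx'; apply: nDi; exists x, x'; split=> //; [exact: bai|exact: b'ai].
- move=> u u0; have [none|/existsNP [f0 /contrapT f0P]] :=
      pselect (forall f, pairing M u f <> 0).
    by exists None; split=> // f; split=> // /none.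
  (* Since [f0] attains the maximum 0, changing it in the single coordinate [j] cannot increase the
     value. *)
  have le_u (f : J) j : u (inr (j, val f j)) <= u (inr (j, val f0 j)).
    have [|f' f'E] := mk (fun j' => if j' == j then val f j' else val f0 j').
      by move=> j'; case: eqP.
    have := u0 f'; rewrite -f0P !ME lerD2l (bigD1 j) //= [leRHS](bigD1 j) //=.
    rewrite f'E eqxx (eq_bigr (fun j' => u (inr (j', val f0 j')))) ?lerD2r //.
    by move=> j' /negbTE jj'; rewrite f'E jj'.
  pose Y j y := u (inr (j, y)) = u (inr (j, val f0 j)).
  (* The face cut out by [u]: the optimal vertices in the coordinates of [D], all of [a]
     elsewhere. *)
  pose phi i := [set x | iota a i x /\ forall j y, i = p j -> x = q y -> Y j y].
  have [||b bE] := box_sub bX (a := a) (phi := phi).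
  - move=> i; have [/pD [j ij]|nDi] := pselect (D i).
      exists (q (val f0 j)); split; first by rewrite ij.
      by move=> j' y; rewrite ij => /pI <- /qI <-.
    have [x ax] := box_neq0 bX a i; exists x; split=> // j y ij.
    by case: nDi; apply/pD; exists j.
  - by move=> i x [].
  exists (Some b); split; first by apply/(box_face bX) => i; rewrite bE => x [].
  move=> f; rewrite /psi bE; split=> [fY|f0E].
    rewrite -f0P !ME; congr (_ + _); apply: eq_bigr => j _.
    exact: (fY j).2.
  move=> j; split=> // j' y /pI <- /qI <-; rewrite /Y.
  have E : \sum_j (u (inr (j, val f0 j)) - u (inr (j, val f j))) = 0.
    rewrite sumrB; apply/eqP; rewrite subr_eq0; apply/eqP.
    by apply: (@addrI _ (u (inl ord0))); rewrite -!ME f0P.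
  have ge0 i' : 0 <= u (inr (i', val f0 i')) - u (inr (i', val f i')).
    by rewrite subr_ge0.
  apply/esym/eqP; rewrite -subr_eq0; apply/eqP.
  exact: (psumr_eq0P (fun i' _ => ge0 i') E (i := j) isT).
move=> [b|] /= ba; last first.
  (* The constant functional -1 vanishes at no generator and so exposes the empty face. *)
  exists (fun c => if c is inl _ then - 1 else 0); split=> f; rewrite ME big1 ?addr0 //.
    by rewrite oppr_le0 ler01.
  by split=> // /eqP; rewrite oppr_eq0 oner_eq0.
(* Every chosen vertex outside [b] costs 1, so the total vanishes exactly at the generators of
   [b]. *)
pose w j y : R := (~~ `[< iota b (p j) (q y) >])%:R.
exists (fun c => match c with inl _ => 0 | inr jy => - w jy.1 jy.2 end).
have wE f : pairing M (fun c => match c with inl _ => 0 | inr jy => - w jy.1 jy.2 end) f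
    = - \sum_j w j (val f j) by rewrite ME add0r sumrN.
split=> f; rewrite wE.
  by rewrite oppr_le0; apply: sumr_ge0 => j _; exact: ler0n.
split=> [fb|/eqP].
  by rewrite big1 ?oppr0 // => j _; rewrite /w; have /asboolP -> := fb j.
rewrite oppr_eq0 => /eqP w0 j; apply/asboolP.
have := psumr_eq0P (fun j' _ => ler0n _ _) w0 (i := j) isT.
by rewrite /w; case: `[< _ >] => //= /eqP; rewrite oner_eq0.
Qed.

(** A functional on the product of the two cones is a pair of functionals, and its zero set is the
    disjoint union of theirs. Faces of the join are thus pairs of possibly empty faces. *)
Lemma polytopal_join (R : realType) (X Y : cell_complex) (t : join_complex X Y) :
  (forall s s' : join_complex X Y, face s s' -> face s' s -> s = s') ->
  cone_rep R (join_left t) -> cone_rep R (join_right t) -> polytopal R t.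
Proof.
move=> aXY [J1 [C1 [M1 [h1 [psi1 [hM1 le1 cut1 exp1]]]]]].
move=> [J2 [C2 [M2 [h2 [psi2 [hM2 le2 cut2 exp2]]]]]].
pose M (j : J1 + J2) (c : C1 + C2) : R :=
  match j, c with inl j, inl c => M1 j c | inr j, inr c => M2 j c | _, _ => 0 end.
pose psi (s : join_complex X Y) (j : J1 + J2) :=
  match j with inl j => psi1 (join_left s) j | inr j => psi2 (join_right s) j end.
have ML u j : pairing M u (inl j) = pairing M1 (fun c => u (inl c)) j.
  by rewrite /pairing big_sumType /= [X in _ + X]big1 ?addr0 // => c _; rewrite mul0r.
have MR u j : pairing M u (inr j) = pairing M2 (fun c => u (inr c)) j.
  by rewrite /pairing big_sumType /= big1 ?add0r // => c _; rewrite mul0r.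
have ne1 s : oface (Some s) (join_left t) -> exists j, psi1 (Some s) j.
  move=> st; apply: contrapT => /forallNP H.
  have : oface (Some s) None by apply/(le1 _ _ st) => // j /H.
  by [].
have ne2 s : oface (Some s) (join_right t) -> exists j, psi2 (Some s) j.
  move=> st; apply: contrapT => /forallNP H.
  have : oface (Some s) None by apply/(le2 _ _ st) => // j /H.
  by [].
apply: (@polytopal_cone R _ t _ _ M
  (fun c => match c with inl c => h1 c | inr c => h2 c end) psi) => //.
- by move=> [j|j]; rewrite ?ML ?MR; [case: (hM1 j)|case: (hM2 j)].
- move=> [a|b|a b] [/= st1 st2].
  + by have [j aj] := ne1 a st1; exists (inl j).
  + by have [j bj] := ne2 b st2; exists (inr j).
  + by have [j aj] := ne1 a st1; exists (inl j).
- move=> s s' [st1 st2] [s't1 s't2]; split.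
    by move=> [/le1 H1 /le2 H2] [j|j]; [apply: H1|apply: H2].
  move=> H; split; first by apply/le1 => // j; exact: (H (inl j)).
  by apply/le2 => // j; exact: (H (inr j)).
- move=> u u0 [j j0].
  have [|s1 [st1 sP1]] := cut1 (fun c => u (inl c)).
    by move=> i; rewrite -ML.
  have [|s2 [st2 sP2]] := cut2 (fun c => u (inr c)).
    by move=> i; rewrite -MR.
  (* The two faces are not both empty, because [u] vanishes at the generator [j]. *)
  have [s [sL sR]] : exists s : join_complex X Y, join_left s = s1 /\ join_right s = s2.
    case: s1 s2 {st1 st2} sP1 sP2 => [a|] [b|] sP1 sP2.
    + by exists (JoinB a b).
    + by exists (JoinL a).
    + by exists (JoinR b).
    case: j j0 => j; first by rewrite ML => /sP1/(hM1 j).2.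
    by rewrite MR => /sP2/(hM2 j).2.
  exists s; split; first by split; rewrite ?sL ?sR.
  by move=> [i|i]; rewrite /psi /= ?sL ?sR ?ML ?MR.
move=> s [/exp1 [u1 [u10 u1P]] /exp2 [u2 [u20 u2P]]].
exists (fun c => match c with inl c => u1 c | inr c => u2 c end).
split=> -[j|j]; rewrite ?ML ?MR; first exact: u10.
- exact: u20.
- exact: u1P.
- exact: u2P.
Qed.

(** * The join complex and the deformation through it *)

Lemma join_poset (X Y : cell_complex) :
  poset X -> poset Y -> poset (join_complex X Y).
Proof.
move=> [rX aX tX] [rY aY tY]; split.
- by move=> [a|b|a b]; split; try exact: rX; try exact: rY.
- move=> [a|b|a b] [a'|b'|a' b'] /= [s1 s2] [t1 t2] //.
  + by rewrite (aX _ _ s1 t1).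
  + by rewrite (aY _ _ s2 t2).
  + by rewrite (aX _ _ s1 t1) (aY _ _ s2 t2).
move=> [a|b|a b] [a'|b'|a' b'] [a''|b''|a'' b''] /= [s1 s2] [t1 t2] //.
all: by split=> //; (exact: tX t1 || exact: tY t2).
Qed.

Lemma join_polyhedral (R : realType) (X Y : cell_complex) :
  poset X -> poset Y -> (forall a : X, cone_rep R (Some a)) ->
  (forall b : Y, cone_rep R (Some b)) -> polyhedral R (join_complex X Y).
Proof.
move=> pX pY cX cY; have [rM aM tM] := join_poset pX pY; split=> // t.
apply: polytopal_join => //; case: t => [a|b|a b] //=; exact: cone_rep_none.
Qed.

Lemma join_finite (X Y : cell_complex) :
  finite_complex X -> finite_complex Y -> finite_complex (join_complex X Y).
Proof.
move=> fX fY.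
apply: (@sub_finite_set _ _ ((range JoinL `|` range JoinR) `|`
    [set JoinB p.1 p.2 | p in [set: X] `*` [set: Y]])).
  by move=> [a|b|a b] _; [left; left; exists a|left; right; exists b|right; exists (a, b)].
rewrite !finite_setU; split; first by split; exact: finite_image.
exact/finite_image/finite_setX.
Qed.

Lemma isomorphic_joinL (X Y : cell_complex) :
  isomorphic X (subcomplex [set (JoinL a : join_complex X Y) | a in [set: X]]).
Proof.
exists (fun a => exist _ (JoinL a) (ex_intro2 _ _ a I erefl)); split; last first.
  by move=> a b; split=> [|[]].
split=> //; first by move=> a b _ _ /(congr1 sval) [].
by move=> [m [a ? am]] _; exists a => //; exact: eq_exist.
Qed.

(** Exchanging the sides turns the collapse onto the left factor into one onto the right factor. *)
Lemma isomorphic_swap (X Y : cell_complex) (rel : X -> Y -> Prop) :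
  isomorphic (subcomplex (linked rel)) (subcomplex (linked (fun b a => rel a b))).
Proof.
pose sw X Y (m : join_cell X Y) : join_cell Y X :=
  match m with JoinL a => JoinR a | JoinR b => JoinL b | JoinB a b => JoinB b a end.
have swP (m : join_complex X Y) : linked rel m -> linked (fun b a => rel a b) (sw _ _ m).
  by case: m.
exists (fun m => exist _ (sw _ _ (sval m)) (swP _ (svalP m))); split; last first.
  by move=> [[a|b|a b] ?] [[a'|b'|a' b'] ?] /=; split=> -[].
split=> //.
  move=> [m mP] [m' m'P] _ _ [E]; apply: eq_exist.
  by case: m m' E {mP m'P} => [a|b|a b] [a'|b'|a' b'] //= []; congruence.
move=> [m mP] _.
have mP' : linked rel (sw _ _ m) by case: m mP.
by exists (exist _ (sw _ _ m) mP') => //; apply: eq_exist => /=; case: m {mP mP'}.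
Qed.

Lemma joinL_lower (X Y : cell_complex) :
  lower [set (JoinL a : join_complex X Y) | a in [set: X]].
Proof.
move=> c d cd [a _ da]; subst d; case: c cd => [c|c|c c'] /= []//.
by exists c.
Qed.

(** [X] expands to the complex of linked pairs, which, with its sides exchanged, collapses to [Y].
    Each of the two cone conditions serves one of these moves. *)
Lemma she_linked (R : realType) (X Y : cell_complex) (I V I' V' : Type)
    (iota : X -> I -> set V) (iota' : Y -> I' -> set V') (rel : X -> Y -> Prop) :
  finite_complex X -> finite_complex Y -> box iota -> box iota' ->
  (forall a a' b b', face a a' -> face b b' -> rel a' b' -> rel a b) ->
  (forall b, exists w, rel w b /\
     forall a, rel a b -> exists c, [/\ rel c b, face a c & face w c]) ->
  (forall a, exists w, rel a w /\
     forall b, rel a b -> exists c, [/\ rel a c, face b c & face w c]) ->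
  simple_homotopy_equivalent R X Y.
Proof.
move=> fX fY bX bY rl coneX coneY.
have pX := box_poset bX; have pY := box_poset bY.
have pXY : polyhedral R (join_complex X Y).
  by apply: join_polyhedral => // ?; [exact: cone_rep_box bX|exact: cone_rep_box bY].
have pYX : polyhedral R (join_complex Y X).
  by apply: join_polyhedral => // ?; [exact: cone_rep_box bY|exact: cone_rep_box bX].
have fXY := join_finite fX fY; have fYX := join_finite fY fX.
have rl' b b' a a' : face b b' -> face a a' -> rel a' b' -> rel a b.
  by move=> bb' aa'; exact: rl.
have emb W Z : polyhedral R (join_complex W Z) -> polyhedral R W.
  apply: (@polyhedral_embed R W (join_complex W Z) JoinL); first by move=> a b [].
    by move=> a b; split=> [|[]].
  exact: joinL_lower.
have X0 : simple_homotopy_equivalent R X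
    (subcomplex [set (JoinL a : join_complex X Y) | a in [set: X]]).
  apply: She_iso => //; first exact: emb pXY.
  - exact: finite_sub.
  - exact/polyhedral_sub/pXY/joinL_lower.
  exact: isomorphic_joinL.
have X1 := she_expands fXY pXY (linked_lower rl)
  (collapses_linked fX fY bX pY rl coneX) X0.
have X2 : simple_homotopy_equivalent R X (subcomplex (linked (fun b a => rel a b))).
  apply: she_iso_r X1; first exact: isomorphic_swap.
  - exact: finite_sub.
  - by apply: polyhedral_sub pYX; exact: linked_lower.
have X3 := she_collapses fYX pYX (linked_lower rl')
  (collapses_linked fY fX bY pX rl' coneY) X2.
apply: she_iso_r X3 => //; first exact/isomorphic_sym/isomorphic_joinL.
exact: emb pYX.
Qed.

(** * Hom complexes as products of simplices, and the adjunction between them *)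

Lemma multihom_sub (T G : graph) (eta phi : T -> set G) :
  multihom eta -> (forall x, phi x !=set0) -> (forall x, phi x `<=` eta x) ->
  multihom phi.
Proof.
move=> [_ f_eta s_eta e_eta] phi0 phi_eta; split=> //.
- by move=> x; exact: sub_finite_set (f_eta x).
- apply: sub_finite_set s_eta => x [a [b [xa xb ab]]].
  by exists a, b; split=> //; exact: phi_eta.
by move=> x y xy [a b] [/phi_eta ax /phi_eta by_]; exact: (e_eta x y xy).
Qed.

Lemma Hom_box (T G : graph) : box (fun (eta : Hom_complex T G) x => sval eta x).
Proof.
split=> //.
- by move=> a b ab; exact: sval_inj.
- by move=> [eta []].
- by move=> [eta []].
- by move=> [eta []].
move=> [eta Heta] phi phi0 phi_eta.
by exists (exist _ phi (multihom_sub Heta phi0 phi_eta)).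
Qed.

(** Disjoint unions of the index types and of the vertex types merge the two families of sets into
    one, as [box] demands. *)
Definition Hom_prod_iota (T G G' : graph)
    (p : complex_prod (Hom_complex T G) (Hom_complex T G')) (i : T + T) :
    set (G + G') :=
  match i with
  | inl x => [set inl a | a in sval p.1 x]
  | inr x => [set inr a | a in sval p.2 x]
  end.

Lemma Hom_prod_box (T G G' : graph) : box (@Hom_prod_iota T G G').
Proof.
split.
- move=> [a a'] [b b'] /=; split=> [[ab ab'] [x|x] _ /= [y ay <-]|ab].
  + by exists y => //; exact: ab.
  + by exists y => //; exact: ab'.
  split=> x y ay.
    by have [|z bz [<-]] := ab (inl x) (inl y); first by exists y.
  by have [|z bz [<-]] := ab (inr x) (inr y); first by exists y.
- move=> [a a'] [b b'] E; congr (_, _); apply: sval_inj; apply: funext => x.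
    have := congr1 (fun f => f (inl x)) E; rewrite /= => /seteqP [ab ba].
    apply/seteqP; split=> y ay.
      by have [|z bz [<-]] := ab (inl y); first by exists y.
    by have [|z bz [<-]] := ba (inl y); first by exists y.
  have := congr1 (fun f => f (inr x)) E; rewrite /= => /seteqP [ab ba].
  apply/seteqP; split=> y ay.
    by have [|z bz [<-]] := ab (inr y); first by exists y.
  by have [|z bz [<-]] := ba (inr y); first by exists y.
- move=> [[a [a0 ? ? ?]] [a' [a'0 ? ? ?]]] [x|x] /=.
    by have [y ay] := a0 x; exists (inl y), y.
  by have [y ay] := a'0 x; exists (inr y), y.
- move=> [[a [? fa ? ?]] [a' [? fa' ? ?]]] [x|x] /=; exact: finite_image.
- move=> [[a [? ? sa ?]] [a' [? ? sa' ?]]] /=.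
  apply: (@sub_finite_set _ _ ([set inl x | x in
      [set x | exists y z, [/\ a x y, a x z & y <> z]]] `|` [set inr x | x in
      [set x | exists y z, [/\ a' x y, a' x z & y <> z]]])); last first.
    by rewrite finite_setU; split; exact: finite_image.
  move=> [x|x] /= [_ [_ [[y ay <-] [z az <-] yz]]]; [left|right]; exists x => //.
    by exists y, z; split=> // E; apply: yz; rewrite E.
  by exists y, z; split=> // E; apply: yz; rewrite E.
move=> [[a Ha] [a' Ha']] phi phi0 phia.
have H1 : multihom (fun x => [set y | phi (inl x) (inl y)]).
  apply: (multihom_sub Ha) => x.
    by have [y phiy] := phi0 (inl x); have [z _ zy] := phia _ _ phiy; exists z; rewrite /= zy.
  by move=> y /phia [z az [<-]].
have H2 : multihom (fun x => [set y | phi (inr x) (inr y)]).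
  apply: (multihom_sub Ha') => x.
    by have [y phiy] := phi0 (inr x); have [z _ zy] := phia _ _ phiy; exists z; rewrite /= zy.
  by move=> y /phia [z az [<-]].
exists (exist _ _ H1, exist _ _ H2); apply: funext => -[x|x]; apply/seteqP; split.
- by move=> _ [y phiy <-].
- by move=> y phiy; have [z _ zy] := phia _ _ phiy; exists z => //=; rewrite zy.
- by move=> _ [y phiy <-].
- by move=> y phiy; have [z _ zy] := phia _ _ phiy; exists z => //=; rewrite zy.
Qed.

Lemma multihom_setX (T G G' : graph) (a : T -> set G) (a' : T -> set G') :
  multihom a -> multihom a' ->
  @multihom T (direct_product G G') (fun x => a x `*` a' x).
Proof.
move=> [a0 fa sa ea] [a'0 fa' sa' ea']; split.
- by move=> x; have [y ay] := a0 x; have [z az] := a'0 x; exists (y, z).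
- by move=> x; exact: finite_setX.
- apply: (@sub_finite_set _ _ ([set x | exists y z, [/\ a x y, a x z & y <> z]] `|`
     [set x | exists y z, [/\ a' x y, a' x z & y <> z]])); last first.
    by rewrite finite_setU.
  move=> x [[y y'] [[z z'] [[/= ay ay'] [/= az az'] yz]]].
  have [E|N] := pselect (y = z); last by left; exists y, z.
  by right; exists y', z'; split=> // E'; apply: yz; rewrite E E'.
move=> x y xy [[u u'] [v v']] [[/= au au'] [/= av av']]; split.
  exact: (ea x y xy (u, v)).
exact: (ea' x y xy (u', v')).
Qed.

Lemma multihom_fst (T G G' : graph) (eta : T -> set (direct_product G G')) :
  multihom eta -> multihom (fun x => [set p.1 | p in eta x] : set G).
Proof.
move=> [eta0 f_eta s_eta e_eta]; split.
- by move=> x; have [p etap] := eta0 x; exists p.1, p.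
- by move=> x; exact: finite_image.
- apply: sub_finite_set s_eta => x [_ [_ [[p etap <-] [q etaq <-] pq]]].
  by exists p, q; split=> // E; apply: pq; rewrite E.
by move=> x y xy [_ _] [[p etap /= <-] [q etaq /= <-]]; have [] := e_eta x y xy (p, q) (conj etap etaq).
Qed.

Lemma multihom_snd (T G G' : graph) (eta : T -> set (direct_product G G')) :
  multihom eta -> multihom (fun x => [set p.2 | p in eta x] : set G').
Proof.
move=> [eta0 f_eta s_eta e_eta]; split.
- by move=> x; have [p etap] := eta0 x; exists p.2, p.
- by move=> x; exact: finite_image.
- apply: sub_finite_set s_eta => x [_ [_ [[p etap <-] [q etaq <-] pq]]].
  by exists p, q; split=> // E; apply: pq; rewrite E.
by move=> x y xy [_ _] [[p etap /= <-] [q etaq /= <-]]; have [] := e_eta x y xy (p, q) (conj etap etaq).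
Qed.

Theorem mainTheorem2 (R : realType) (G H K : graph) :
  finite_complex (Hom_complex G (direct_product H K)) ->
  simple_homotopy_equivalent R
    (Hom_complex G (direct_product H K))
    (complex_prod (Hom_complex G H) (Hom_complex G K)).
Proof.
set A := Hom_complex _ _; set B := complex_prod _ _ => fA.
pose times (b : B) : A :=
  exist _ (fun x => sval b.1 x `*` sval b.2 x) (multihom_setX (svalP b.1) (svalP b.2)).
pose proj (a : A) : B := (exist _ _ (multihom_fst (svalP a)), exist _ _ (multihom_snd (svalP a))).
(* A set of pairs lies in a product exactly when its two projections lie in the factors. *)
have adj a b : face (proj a) b <-> face a (times b).
  split=> [[/= a1 a2] x [y z] ayz|/= ab].
    by split; [apply: a1; exists (y, z)|apply: a2; exists (y, z)].
  by split=> x _ [p ap <-]; have [] := ab x p ap.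
have [rA aA tA] := box_poset (Hom_box G (direct_product H K)).
have [rB aB tB] := box_poset (@Hom_prod_box G H K).
(* Each factor is recovered because the other one is nonempty. *)
have projK b : face b (proj (times b)).
  split=> x y by_ /=.
    by have [z bz] : sval b.2 x !=set0 by [case: b.2 => [? []]]; exists (y, z).
  by have [z bz] : sval b.1 x !=set0 by [case: b.1 => [? []]]; exists (z, y).
have times_mono b b' : face b b' -> face (times b) (times b').
  by move=> bb'; apply/adj; apply: tB bb'; exact/adj.
(* Finiteness passes to [B] because [times] is injective: if [times b = times b'], the adjunction
   gives [b] below [proj (times b)] below [b'], and conversely. *)
have fB : finite_complex B.
  apply: (@finite_complex_inj _ _ times) fA => b b' E.
  apply: aB; apply: tB (projK _) _.
    by apply/adj; rewrite E.
  by apply/adj; rewrite -E.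
(* The intermediate [c] makes the relation lower in both arguments, which [face a (times b)] alone
   is not in [b]. *)
apply: (@she_linked R A B _ _ _ _ _ _
  (fun a b => exists c, face a (times c) /\ face b c) fA fB (Hom_box _ _) (@Hom_prod_box _ _ _)).
- by move=> a a' b b' aa' bb' [c [ac bc]]; exists c; split; [exact: tA ac|exact: tB bc].
(* The common upper bound of [a] and [times b] is [times c]; on the other side, [c] itself bounds
   [b] and [proj a]. *)
- move=> b; exists (times b); split; first by exists b.
  move=> a [c [ac bc]]; exists (times c); split=> //; first by exists c.
  exact: times_mono.
move=> a; exists (proj a); split.
  by exists (proj a); split=> //; exact/adj.
by move=> b [c [ac bc]]; exists c; split=> //; [exists c|exact/adj].
Qed.
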